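(* For all integers $n_1,n_2\ge 3$, $\gamma_{gr}^{t}(C_{n_1}\times C_{n_2})=\gamma_{gr}^{t}(C_{n_1})\,\gamma_{gr}^{t}(C_{n_2})$.
   Context: Graphs are finite, simple and undirected; $C_n$ denotes the cycle on $n\ge 3$ vertices. $N(v)$ denotes the open neighborhood of $v$. A sequence $(v_1,\ldots,v_k)$ of distinct vertices of $G$ is a (legal) open neighborhood sequence if $N(v_i)\setminus\bigcup_{j=1}^{i-1}N(v_j)\neq\emptyset$ for each $i\in\{1,\ldots,k\}$. The Grundy total domination number $\gamma_{gr}^{t}(G)$ is the maximum length of a legal open neighborhood sequence of $G$. The direct product $G\times H$ has vertex set $V(G)\times V(H)$, and $(g_1,h_1)$, $(g_2,h_2)$ are adjacent iff $g_1g_2\in E(G)$ and $h_1h_2\in E(H)$. *)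

(* Defs.v *)
From mathcomp Require Import all_boot.

Set Implicit Arguments.
Unset Strict Implicit.
Unset Printing Implicit Defensive.

Record sgraph := SGraph {
  vertex :> finType;
  adj : rel vertex;
  adj_sym : symmetric adj;
  adj_irrefl : irreflexive adj
}.

Definition neigh (G : sgraph) (v : G) : {set G} := [set w | adj v w].

Definition legal (G : sgraph) (k : nat) (s : k.-tuple G) : bool :=
  uniq s &&
  [forall i : 'I_k,
    neigh (tnth s i) :\: \bigcup_(j < k | j < i) neigh (tnth s j) != set0].

(* The vertices of a sequence are distinct, so bounding its length by #|G|
   loses nothing; see grundy_total_max. *)
Definition grundy_total (G : sgraph) : nat :=
  \max_(k < #|G|.+1 | [exists s : k.-tuple G, legal s]) k.

Lemma grundy_total_max (G : sgraph) (k : nat) (s : k.-tuple G) :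
  legal s -> k <= grundy_total G.
Proof.
move=> sL; have lek : k < #|G|.+1.
  case/andP: (sL) => /card_uniqP us _.
  by rewrite ltnS -(size_tuple s) -us max_card.
apply: (@bigmax_sup _ (Ordinal lek)) => //.
by apply/existsP; exists s.
Qed.

Lemma grundy_total_attained (G : sgraph) :
  exists s : (grundy_total G).-tuple G, legal s.
Proof.
pose P (k : 'I_#|G|.+1) := [exists s : k.-tuple G, legal s].
have P0 : P ord0.
  apply/existsP; exists [tuple]; rewrite /legal /=.
  by apply/forallP => -[].
rewrite /grundy_total (bigmax_eq_arg ord0 (P := P)) //.
by case: arg_maxnP => // i /existsP.
Qed.

(* The condition i != j only matters for n = 1, where ordS i = i. *)
Definition cycle_adj (n : nat) : rel 'I_n :=
  fun i j => (i != j) && ((j == ordS i) || (i == ordS j)).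

Lemma cycle_adj_sym n : symmetric (@cycle_adj n).
Proof. by move=> i j; rewrite /cycle_adj eq_sym orbC. Qed.

Lemma cycle_adj_irrefl n : irreflexive (@cycle_adj n).
Proof. by move=> i; rewrite /cycle_adj eqxx. Qed.

Definition cycle_graph (n : nat) : sgraph :=
  SGraph (@cycle_adj_sym n) (@cycle_adj_irrefl n).

Definition direct_adj (G H : sgraph) : rel (G * H)%type :=
  fun x y => adj x.1 y.1 && adj x.2 y.2.

Lemma direct_adj_sym G H : symmetric (@direct_adj G H).
Proof. by move=> x y; rewrite /direct_adj adj_sym (adj_sym x.2). Qed.

Lemma direct_adj_irrefl G H : irreflexive (@direct_adj G H).
Proof. by move=> x; rewrite /direct_adj adj_irrefl. Qed.

Definition direct_product (G H : sgraph) : sgraph :=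
  SGraph (@direct_adj_sym G H) (@direct_adj_irrefl G H).

(* Main.v *)
(** A legal sequence of length k singles out a k x k triangular submatrix with
    nonzero diagonal of the adjacency matrix, so the Grundy total domination
    number is at most the rank of that matrix, here taken over F_2.  The
    adjacency matrix of a direct product is the Kronecker product of those of
    the factors, so its rank is at most the product of the ranks.  For cycles
    the bound is sharp: if n is even the indicators of the two parity classes,
    if n is odd the constant vector, lie in the kernel, and explicit legal
    sequences of length n - 2, respectively n - 1, exist.  Conversely, ordering
    the products of two legal sequences lexicographically gives a legal
    sequence in the direct product. *)

Require Import Defs.
From mathcomp Require Import all_boot all_algebra.
From mathcomp Require Import zify.

Set Implicit Arguments.
Unset Strict Implicit.
Unset Printing Implicit Defensive.

Import GRing.Theory.

(* [w i] is a vertex newly dominated by [v i]. *)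
Definition footprints (G : sgraph) (k : nat) (v w : 'I_k -> G) :=
  (forall i, adj (v i) (w i)) /\ (forall i j : 'I_k, j < i -> ~~ adj (v j) (w i)).

Lemma footprints_le_grundy (G : sgraph) (k : nat) (v w : 'I_k -> G) :
  footprints v w -> k <= grundy_total G.
Proof.
move=> [vw vw0].
(* A repeated vertex would, at its first occurrence, already dominate the vertex footprinted at its
   second. *)
have vI : injective v.
  move=> i j vij; apply: val_inj; case: (ltngtP i j) => // ij.
    by have := vw0 _ _ ij; rewrite vij vw.
  by have := vw0 _ _ ij; rewrite -vij vw.
apply: (@grundy_total_max _ _ [tuple v i | i < k]).
apply/andP; split; first by rewrite map_inj_uniq ?enum_uniq.
apply/forallP => i; apply/set0Pn; exists (w i).
rewrite inE tnth_mktuple inE vw andbT; apply/bigcupP => -[j ji].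
by rewrite tnth_mktuple inE (negbTE (vw0 _ _ ji)).
Qed.

Lemma grundy_footprints (G : sgraph) :
  exists v w : 'I_(grundy_total G) -> G, footprints v w.
Proof.
have [s /andP[_ /forallP sL]] := grundy_total_attained G.
have /fin_all_exists[w wP] (i : 'I_(grundy_total G)) := set0Pn _ (sL i).
exists (tnth s), w; split=> [i|i j ji].
  by have := wP i; rewrite !inE => /andP[].
have := wP i; rewrite inE => /andP[/bigcupP wN _].
by apply/negP => a; apply: wN; exists j; rewrite ?inE.
Qed.

Lemma grundy_direct_product_ge (G H : sgraph) :
  grundy_total G * grundy_total H <= grundy_total (direct_product G H).
Proof.
have [v1 [w1 [a1 n1]]] := grundy_footprints G.
have [v2 [w2 [a2 n2]]] := grundy_footprints H.
set k1 := grundy_total G in v1 w1 a1 n1 *.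
set k2 := grundy_total H in v2 w2 a2 n2 *.
have k2_gt0 (i : 'I_(k1 * k2)) : 0 < k2.
  by have := leq_ltn_trans (leq0n i) (ltn_ord i); rewrite muln_gt0 => /andP[].
have q_lt (i : 'I_(k1 * k2)) : i %/ k2 < k1 by rewrite ltn_divLR ?(k2_gt0 i).
have r_lt (i : 'I_(k1 * k2)) : i %% k2 < k2 by rewrite ltn_pmod ?(k2_gt0 i).
pose q i := Ordinal (q_lt i); pose r i := Ordinal (r_lt i).
apply: (@footprints_le_grundy (direct_product G H) _
         (fun i => (v1 (q i), v2 (r i))) (fun i => (w1 (q i), w2 (r i)))).
split=> [i|i j ji]; rewrite /adj /= /direct_adj /= ?a1 ?a2 //.
(* Lexicographic order: for [j < i] either the quotients agree and the remainders increase, so the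
   second coordinates are non-adjacent, or the quotients increase and the first coordinates are. *)
have := leq_div2r k2 (ltnW ji); rewrite leq_eqVlt => /orP[/eqP eq_q|lt_q].
  rewrite negb_and n2 ?orbT //=.
  by have := divn_eq i k2; have := divn_eq j k2; lia.
by rewrite negb_and n1.
Qed.

Lemma val_ordS (n : nat) (i : 'I_n) :
  ordS i = (if i.+1 == n then 0 else i.+1) :> nat.
Proof.
have := ltn_ord i => /=; case: eqVneq => [->|ne lt]; first by rewrite modnn.
by rewrite modn_small; lia.
Qed.

Lemma val_ord_pred (n : nat) (i : 'I_n) :
  ord_pred i = (if val i == 0 then n.-1 else i.-1) :> nat.
Proof.
have := ltn_ord i => i_lt /=; case: eqVneq => [->|ne].
  by rewrite modn_small; lia.
by rewrite -(prednK (n := i)) ?lt0n // addSn /= modnDr modn_small; lia.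
Qed.

Lemma cycle_adjE (n : nat) (i j : 'I_n) : 3 <= n ->
  cycle_adj i j = (i == ord_pred j) || (i == ordS j).
Proof.
move=> n3; rewrite /cycle_adj -(can2_eq (@ordSK n) (@ord_predK n)) eq_sym.
have ordS_neq (k : 'I_n) : k != ordS k.
  by rewrite -val_eqE [val (ordS _)]val_ordS; have := ltn_ord k; case: ifP => /=; lia.
rewrite (eq_sym (ordS i)); case: eqVneq => //= ->.
by rewrite (negbTE (ordS_neq i)).
Qed.

Local Open Scope ring_scope.

(** A witness that the adjacency matrix has rank at most [#|K|]. With an arbitrary finite index
    type, pairs can index the Kronecker product directly. *)
Definition adj_factorization (G : sgraph) (K : finType)
    (B : G -> K -> 'F_2) (C : K -> G -> 'F_2) :=
  forall u v, \sum_k B u k * C k v = (adj u v)%:R.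

Lemma grundy_le_factorization (G : sgraph) (K : finType)
    (B : G -> K -> 'F_2) (C : K -> G -> 'F_2) :
  adj_factorization B C -> (grundy_total G <= #|K|)%N.
Proof.
move=> BC; have [v [w [vw vw0]]] := grundy_footprints G.
set k := grundy_total G in v w vw vw0 *.
pose BM := \matrix_(i < k, l < #|K|) B (v i) (enum_val l).
pose CM := \matrix_(l < #|K|, j < k) C (enum_val l) (w j).
have BCE i j : (BM *m CM) i j = (adj (v i) (w j))%:R.
  rewrite -BC mxE (reindex (@enum_val K predT)) /=.
    by apply: eq_bigr => l _; rewrite !mxE.
  by apply/onW_bij/enum_val_bij.
have trig : is_trig_mx (BM *m CM).
  apply/is_trig_mxP => i j ij.
  by rewrite BCE (negbTE (vw0 _ _ ij)).
have unit : BM *m CM \in unitmx.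
  rewrite unitmxE det_trig // big1 ?unitr1 // => i _.
  by rewrite BCE vw.
by rewrite -[X in (X <= _)%N](mxrank_unit unit) mulmx_max_rank.
Qed.

Lemma direct_product_factorization (G H : sgraph) (K L : finType)
    (B : G -> K -> 'F_2) (C : K -> G -> 'F_2)
    (B' : H -> L -> 'F_2) (C' : L -> H -> 'F_2) :
  adj_factorization B C -> adj_factorization B' C' ->
  @adj_factorization (direct_product G H) (K * L)%type
    (fun u k => B u.1 k.1 * B' u.2 k.2) (fun k v => C k.1 v.1 * C' k.2 v.2).
Proof.
move=> BC BC' u v.
rewrite /adj /= /direct_adj -mulnb natrM -BC -BC' big_distrlr pair_bigA /=.
by apply: eq_bigr => k _; rewrite mulrACA.
Qed.

Definition cycle_mx (n : nat) : 'M['F_2]_n :=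
  \matrix_(i, j) (cycle_adj i j)%:R.

Lemma sum_cycle_mx (n : nat) (f : 'I_n -> 'F_2) (j : 'I_n) : (3 <= n)%N ->
  \sum_i f i * cycle_mx n i j = f (ord_pred j) + f (ordS j).
Proof.
move=> n3; have neq : ord_pred j != ordS j.
  rewrite -val_eqE [val (ordS _)]val_ordS [val (ord_pred _)]val_ord_pred.
  by have := ltn_ord j; case: ifP; case: ifP => /=; lia.
rewrite (bigD1 (ord_pred j)) // (bigD1 (ordS j)) 1?eq_sym //= big1 => [|i].
  by rewrite !mxE !cycle_adjE // !eqxx orbT !mulr1 addr0.
by case/andP=> i1 i2; rewrite mxE cycle_adjE // (negbTE i1) (negbTE i2) mulr0.
Qed.

(** As [d] divides both 2 and [n], the two neighbors of a vertex lie in the same class mod [d], so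
    each class indicator (a row of [D]) is a left kernel vector in characteristic 2. These rows are
    independent: [E] selects the first [d] columns of [D], an identity block. *)
Lemma rank_cycle_mx (n d : nat) : (3 <= n)%N -> (0 < d <= 2)%N -> (d %| n)%N ->
  (\rank (cycle_mx n) <= n - d)%N.
Proof.
move=> n3 d12 dn.
pose D := \matrix_(i < d, j < n) (j %% d == i)%N%:R : 'M['F_2]_(d, n).
pose E := \matrix_(j < n, i < d) (val j == i)%:R : 'M['F_2]_(n, d).
have rD : \rank D = d.
  apply/eqP/row_freeP; exists E; apply/matrixP => i l.
  have ln : (l < n)%N by have := ltn_ord l; lia.
  rewrite !mxE (bigD1 (Ordinal ln)) //= !mxE eqxx mulr1 modn_small ?(ltn_ord l) //.
  rewrite big1 ?addr0 => [|j jl]; first by rewrite eq_sym.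
  by rewrite !mxE (_ : val j == l = false) ?mulr0 //; apply: negbTE; exact: jl.
have DA : D *m cycle_mx n = 0.
  apply/matrixP => i j; rewrite [LHS]mxE sum_cycle_mx // !mxE /=.
  have -> : ((j + n).-1 %% n %% d = j.+1 %% n %% d)%N.
    rewrite !modn_dvdm //.
    have -> : ((j + n).-1 = j.+1 + (n - 2))%N by lia.
    have d2 : (d %| 2)%N by case: (d) d12 => [|[|[|]]].
    by rewrite -modnDmr (eqP (dvdn_sub dn d2)) addn0.
  by case: (_ == _); apply/val_inj.
by have := mulmx0_rank_max DA; rewrite rD; lia.
Qed.

Local Close Scope ring_scope.

(** Walk along 1, ..., n-2, each vertex footprinting its successor. The walk avoids 0, which is
    adjacent to n-1, the last vertex footprinted. *)
Lemma grundy_cycle_ge (n : nat) : 3 <= n ->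
  n - 2 <= grundy_total (cycle_graph n).
Proof.
move=> n3.
have v_lt (i : 'I_(n - 2)) : i.+1 < n by have := ltn_ord i; lia.
have w_lt (i : 'I_(n - 2)) : i.+2 < n by have := ltn_ord i; lia.
apply: (@footprints_le_grundy (cycle_graph n) _
         (fun i => Ordinal (v_lt i)) (fun i => Ordinal (w_lt i))).
split=> [i|i j ji]; rewrite /adj /= /cycle_adj -!val_eqE /=.
  by have := ltn_ord i; rewrite modn_small //; lia.
rewrite (@modn_small j.+2) //; have := w_lt i.
rewrite leq_eqVlt => /orP[/eqP nE|lt].
  by rewrite [in _ %% _]nE modnn; lia.
by rewrite modn_small //; lia.
Qed.

Lemma double_succ_modn_neq (n a b : nat) : odd n -> a < b < a + n ->
  a.*2.+1 != b.*2.+1 %[mod n].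
Proof.
move=> n_odd ab; rewrite eq_sym eqn_mod_dvd; last by lia.
have -> : b.*2.+1 - a.*2.+1 = 2 * (b - a) by lia.
rewrite Gauss_dvdr ?coprimen2 //.
by apply/negP => /dvdn_leq; lia.
Qed.

(** Walk in steps of two: the neighbors of [w i] are [v i] and 2i+3 mod n, the next vertex of the
    walk. As n is odd, the walk returns to a vertex only after n steps, so neither neighbor occurs
    before [v i]. *)
Lemma grundy_cycle_odd_ge (n : nat) : 3 <= n -> odd n ->
  n.-1 <= grundy_total (cycle_graph n).
Proof.
move=> n3 n_odd; have n0 : 0 < n by lia.
pose v (i : 'I_n.-1) := Ordinal (ltn_pmod i.*2.+1 n0).
pose w (i : 'I_n.-1) := Ordinal (ltn_pmod i.*2.+2 n0).
have wE i : w i = ordS (v i).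
  by apply: val_inj; rewrite /= -[in RHS]addn1 modnDml addn1.
apply: (@footprints_le_grundy (cycle_graph n) _ v w).
split=> [i|i j ji]; rewrite /adj /= ?cycle_adjE //.
  by rewrite wE ordSK eqxx.
rewrite negb_or wE ordSK -wE -!val_eqE /=.
have -> : (i.*2.+2 %% n).+1 %% n = i.+1.*2.+1 %% n.
  by rewrite -addn1 modnDml addn1.
have := ltn_ord i => i_lt.
apply/andP; split; apply: double_succ_modn_neq => //; lia.
Qed.

Local Open Scope ring_scope.

Lemma cycle_factorization (n : nat) : (3 <= n)%N ->
  exists r (B : cycle_graph n -> 'I_r -> 'F_2) (C : 'I_r -> cycle_graph n -> 'F_2),
    adj_factorization B C /\ (r <= grundy_total (cycle_graph n))%N.
Proof.
move=> n3; exists (\rank (cycle_mx n)).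
(* A full-rank factorization: its inner dimension is exactly the rank. *)
exists (fun i k => col_base (cycle_mx n) i k).
exists (fun k j => row_base (cycle_mx n) k j); split=> [i j|].
  have /matrixP/(_ i j) := mulmx_base (cycle_mx n).
  by rewrite [LHS]mxE [RHS]mxE.
have [n_odd|n_even] := boolP (odd n).
  apply: leq_trans (grundy_cycle_odd_ge n3 n_odd).
  by rewrite -subn1 rank_cycle_mx.
apply: leq_trans (grundy_cycle_ge n3).
by rewrite rank_cycle_mx // dvdn2.
Qed.

Local Close Scope ring_scope.

Theorem theorem2p12 (n1 n2 : nat) (hn1 : 3 <= n1) (hn2 : 3 <= n2) :
  grundy_total (direct_product (cycle_graph n1) (cycle_graph n2)) =
  grundy_total (cycle_graph n1) * grundy_total (cycle_graph n2).
Proof.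
apply/eqP; rewrite eqn_leq grundy_direct_product_ge andbT.
have [r1 [B1 [C1 [BC1 le1]]]] := cycle_factorization hn1.
have [r2 [B2 [C2 [BC2 le2]]]] := cycle_factorization hn2.
apply: leq_trans (leq_mul le1 le2).
have := grundy_le_factorization (direct_product_factorization BC1 BC2).
by rewrite card_prod !card_ord.
Qed.
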